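(* Let $\mathbf{G}$ be a locally cancellative regular semigroupoid. Put $X=G_1$ and let $m\colon X\times X\to X$ be the relation $m=\{((g,f),gf)\mid g,f\in G_1,\ s(g)=t(f)\}$. Then $m$ is a relative H*-algebra.
   Context: A semigroupoid consists of sets $G_0$ (objects), $G_1$ (morphisms), functions $s,t\colon G_1\to G_0$ (source, target) and an associative composition $G_1\times_{G_0}G_1\to G_1$, $(g,f)\mapsto gf$ for $s(g)=t(f)$ (a category without identities); it is assumed that $G_0=s(G_1)\cup t(G_1)$. A pseudoinverse of $f\in G_1$ is $f^*\in G_1$ with $s(f)=t(f^* )$, $t(f)=s(f^* )$, $f=ff^*f$, $f^*=f^*ff^*$. A semigroupoid is regular when every $f\in G_1$ has a pseudoinverse; it is locally cancellative when $fhh^*=gh^*$ implies $fh=g$, and $h^*hf=h^*g$ implies $hf=g$, for any $f,g,h\in G_1$ and any pseudoinverse $h^*$ of $h$. $\mathbf{Rel}$ is the category of sets and relations, with relational composition, converse $r^\dagger$, monoidal product $\times$ given by Cartesian product of sets, and $1$ denoting identities and the one-point set; coherence isomorphisms are suppressed. A relative H*-algebra is a relation $m\colon X\times X\to X$ in $\mathbf{Rel}$ satisfying (M) $m\circ m^\dagger=1$; (A) $m\circ(1\times m)=m\circ(m\times 1)$; (H) there is an involution $*\colon\mathbf{Rel}(1,X)\to\mathbf{Rel}(1,X)$ such that $m\circ(1\times x^* )=(1\times x^\dagger)\circ m^\dagger$ and $m\circ(x^*\times 1)=(x^\dagger\times 1)\circ m^\dagger$ for all $x\colon 1\to X$. 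*)

(* Defs.v *)
From mathcomp Require Import all_boot.
From mathcomp Require Import boolp classical_sets.

Set Implicit Arguments.
Unset Strict Implicit.
Unset Printing Implicit Defensive.

Local Open Scope classical_set_scope.
Local Open Scope relation_scope.

(* The composite [comp g f e], written gf, takes a proof [e] that (g, f) lies
   in the pullback of source and target; the choice of proof is immaterial
   by proof irrelevance. *)
Record semigroupoid := Semigroupoid {
  obj : Type;
  mor : Type;
  src : mor -> obj;
  tgt : mor -> obj;
  comp : forall g f : mor, src g = tgt f -> mor;
  src_comp : forall (g f : mor) (e : src g = tgt f), src (comp e) = src f;
  tgt_comp : forall (g f : mor) (e : src g = tgt f), tgt (comp e) = tgt g;
  compA : forall (h g f : mor) (hg : src h = tgt g) (gf : src g = tgt f)
    (h_gf : src h = tgt (comp gf)) (hg_f : src (comp hg) = tgt f),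
    comp h_gf = comp hg_f;
  obj_cover : range src `|` range tgt = [set: obj]
}.

Section Semigroupoids.
Variable G : semigroupoid.
Implicit Types f g h : mor G.

Definition pseudoinverse f f' : Prop :=
  exists (ff' : src f = tgt f') (f'f : src f' = tgt f),
    f = comp (etrans (src_comp ff') f'f) /\
    f' = comp (etrans (src_comp f'f) ff').

Definition regular : Prop := forall f, exists f', pseudoinverse f f'.

Definition locally_cancellative : Prop :=
  forall f g h h', pseudoinverse h h' ->
    (forall (fh : src f = tgt h) (fh_h' : src (comp fh) = tgt h')
        (gh' : src g = tgt h'),
      comp fh_h' = comp gh' -> comp fh = g) /\
    (forall (hf : src h = tgt f) (h'_hf : src h' = tgt (comp hf))
        (h'g : src h' = tgt g),
      comp h'_hf = comp h'g -> comp hf = g).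

End Semigroupoids.

(* A morphism X -> Y of the category of sets and relations is a term of
   [set (X * Y)]. In [relation_scope], [s \; r] is "s after r" and [r^-1] is
   the converse; [diagonal] is the identity. *)
Notation Rel X Y := (set (X * Y)).

Definition rel_prod X Y X' Y' (r : Rel X Y) (s : Rel X' Y') :
    Rel (X * X') (Y * Y') :=
  [set p | r (p.1.1, p.2.1) /\ s (p.1.2, p.2.2)].

Definition rel_assoc X Y Z : Rel ((X * Y) * Z) (X * (Y * Z)) :=
  [set p | p.2 = (p.1.1.1, (p.1.1.2, p.1.2))].

Definition rel_lunit X : Rel (unit * X) X := [set p | p.2 = p.1.2].

Definition rel_runit X : Rel (X * unit) X := [set p | p.2 = p.1.1].

Arguments rel_assoc X Y Z : clear implicits.
Arguments rel_lunit X : clear implicits.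
Arguments rel_runit X : clear implicits.

(* The coherence isomorphisms are inserted so that both sides of (A) are
   relations (X * X) * X -> X and both sides of each equation of (H) are
   relations X -> X. *)
Definition relative_Hstar_algebra X (m : Rel (X * X) X) : Prop :=
  [/\ m \; m^-1 = diagonal,
      m \; (rel_prod diagonal m \; rel_assoc X X X) = m \; rel_prod m diagonal
    & exists star : Rel unit X -> Rel unit X,
        involutive star /\
        forall x : Rel unit X,
          (m \; rel_prod diagonal (star x)) \; (rel_runit X)^-1 =
            rel_runit X \; (rel_prod diagonal x^-1 \; m^-1) /\
          (m \; rel_prod (star x) diagonal) \; (rel_lunit X)^-1 =
            rel_lunit X \; (rel_prod x^-1 diagonal \; m^-1)].

Definition comp_rel (G : semigroupoid) : Rel (mor G * mor G) (mor G) :=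
  [set p | exists (g f : mor G) (e : src g = tgt f), p = ((g, f), comp e)].

Arguments comp_rel G : clear implicits.

(* Main.v *)
From mathcomp Require Import all_boot.
From mathcomp Require Import boolp classical_sets.
Require Import Defs.

(** Local cancellation makes idempotents into identities: an idempotent e is a
    pseudoinverse of itself, so for k composable with e the equation
    (ke)e = ke is an instance of fhh* = gh* with h = h* = e and f = g = k,
    and cancelling gives ke = k; dually ek = k. Now if h* is a pseudoinverse
    of h, then hh* and h*h are idempotent, hence
      g = kh <-> k = gh*   and   f = hk <-> k = h*f.
    Consequently pseudoinverses are unique, since f'' = f''(ff') = (f''f)f' =
    f' for any two pseudoinverses of f, and a regular locally cancellative
    semigroupoid is a groupoid.

    The involution demanded by (H) sends a set x of morphisms to the set of
    pseudoinverses of its members: uniqueness, together with regularity, makes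
    it an involution, and the two displayed equivalences are exactly the two
    equations of (H) read elementwise. Condition (M) says that composition is
    single valued and that every morphism is a composite; regularity provides
    the factorization h = eh with e = hh*. Condition (A) is associativity,
    including that both bracketings are defined simultaneously.

    All the reasoning is done with the graph of the partial composition, which
    removes the dependency of composites on proofs of composability. *)

Set Implicit Arguments.
Unset Strict Implicit.
Unset Printing Implicit Defensive.

Local Open Scope classical_set_scope.
Local Open Scope relation_scope.

(** * Composition as a ternary relation *)

Section Composite.
Variable G : semigroupoid.
Implicit Types e f g h k l : mor G.

Definition composite g f k : Prop := exists e : src g = tgt f, comp e = k.

Lemma comp_relE g f k : comp_rel G ((g, f), k) <-> composite g f k.
Proof.
split; first by case=> [g' [f' [e [-> -> ->]]]]; exists e.
by case=> e <-; exists g, f, e.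
Qed.

Lemma composite_ex g f : src g = tgt f -> exists k, composite g f k.
Proof. by move=> e; exists (comp e), e. Qed.

Lemma composite_fun g f k k' : composite g f k -> composite g f k' -> k = k'.
Proof. by case=> e <- [e' <-]; rewrite (Prop_irrelevance e e'). Qed.

Lemma composite_composable g f k : composite g f k -> src g = tgt f.
Proof. by case. Qed.

Lemma composite_src g f k : composite g f k -> src k = src f.
Proof. by case=> e <-; exact: src_comp. Qed.

Lemma composite_tgt g f k : composite g f k -> tgt k = tgt g.
Proof. by case=> e <-; exact: tgt_comp. Qed.

Lemma composite_assocl h g f gf l :
  composite g f gf -> composite h gf l ->
  exists2 hg, composite h g hg & composite hg f l.
Proof.
case=> gf_e <- [h_gf <-].
have hg : src h = tgt g by rewrite h_gf tgt_comp.
have hg_f : src (comp hg) = tgt f by rewrite src_comp.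
by exists (comp hg); [exists hg | exists hg_f; rewrite (compA h_gf hg_f)].
Qed.

Lemma composite_assocr h g f hg l :
  composite h g hg -> composite hg f l ->
  exists2 gf, composite g f gf & composite h gf l.
Proof.
case=> hg_e <- [hg_f <-].
have gf : src g = tgt f by rewrite -hg_f src_comp.
have h_gf : src h = tgt (comp gf) by rewrite tgt_comp.
by exists (comp gf); [exists gf | exists h_gf; rewrite (compA h_gf hg_f)].
Qed.

(** * Pseudoinverses and idempotents *)

Lemma pseudoinverse_sym f f' : pseudoinverse f f' -> pseudoinverse f' f.
Proof. by case=> ff' [f'f [Ef Ef']]; exists f'f, ff'. Qed.

Lemma pseudoinverse_src f f' : pseudoinverse f f' -> src f = tgt f'.
Proof. by case. Qed.

Lemma pseudoinverse_factor f f' :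
  pseudoinverse f f' -> exists2 e, composite f f' e & composite e f f.
Proof.
case=> ff' [f'f [Ef _]]; exists (comp ff'); first by exists ff'.
by exists (etrans (src_comp ff') f'f).
Qed.

(** (ff')(ff') = ((ff')f)f' = ff'. *)
Lemma pseudoinverse_idem f f' e :
  pseudoinverse f f' -> composite f f' e -> composite e e e.
Proof.
case/pseudoinverse_factor=> e' ff'e' + ff'e.
rewrite (composite_fun ff'e' ff'e) => eff.
have [e'' ff'e'' ee''e] := composite_assocr eff ff'e.
by rewrite (composite_fun ff'e'' ff'e) in ee''e.
Qed.

Lemma idem_pseudoinverse e : composite e e e -> pseudoinverse e e.
Proof.
move=> [ee Ee]; exists ee, ee.
suff E : e = comp (etrans (src_comp ee) ee) by split.
(* The two sides differ by a replacement of comp ee by e inside a dependent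
   argument, so the equation ee = e is passed through the composite relation. *)
have [p Ep] : composite (comp ee) e e by rewrite Ee; exists ee.
by rewrite -[LHS]Ep; congr comp; exact: Prop_irrelevance.
Qed.

Hypothesis cancel : locally_cancellative G.

(** Cancellation of e from (ke)e = ke, where e is its own pseudoinverse. *)
Lemma idem_right_unit e k :
  composite e e e -> src k = tgt e -> composite k e k.
Proof.
move=> eee ke; exists ke.
have ke_e : src (comp ke) = tgt e.
  by rewrite src_comp; exact: composite_composable eee.
apply: ((cancel k k (idem_pseudoinverse eee)).1 ke ke_e ke).
have [l ee kl] := composite_assocr (ex_intro _ ke erefl : composite k e _)
  (ex_intro _ ke_e erefl).
move: kl; rewrite (composite_fun ee eee) => kl.
by apply: composite_fun kl _; exists ke.
Qed.

Lemma idem_left_unit e k :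
  composite e e e -> src e = tgt k -> composite e k k.
Proof.
move=> eee ek; exists ek.
have e_ek : src e = tgt (comp ek).
  by rewrite tgt_comp; exact: composite_composable eee.
apply: ((cancel k k (idem_pseudoinverse eee)).2 ek e_ek ek).
have [l ee lk] := composite_assocl (ex_intro _ ek erefl : composite e k _)
  (ex_intro _ e_ek erefl).
move: lk; rewrite (composite_fun ee eee) => lk.
by apply: composite_fun lk _; exists ek.
Qed.

(** The composite gh' equals k(hh'), and hh' is idempotent, hence a unit. *)
Lemma composite_divr h h' k g :
  pseudoinverse h h' -> composite k h g -> composite g h' k.
Proof.
move=> hh' khg.
have [l gh'l] : exists l, composite g h' l.
  by apply: composite_ex; rewrite (composite_src khg) (pseudoinverse_src hh').
have [e he kel] := composite_assocr khg gh'l.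
have kek := idem_right_unit (pseudoinverse_idem hh' he)
  (composite_composable kel).
by rewrite (composite_fun kek kel).
Qed.

Lemma composite_divl h h' k f :
  pseudoinverse h h' -> composite h k f -> composite h' f k.
Proof.
move=> hh' hkf; have h'h := pseudoinverse_sym hh'.
have [l h'fl] : exists l, composite h' f l.
  by apply: composite_ex; rewrite (composite_tgt hkf) (pseudoinverse_src h'h).
have [e he ekl] := composite_assocl hkf h'fl.
have ekk := idem_left_unit (pseudoinverse_idem h'h he)
  (composite_composable ekl).
by rewrite (composite_fun ekk ekl).
Qed.

(** With e = f''f, dividing by f on the right gives ef' = f'', while e is
    idempotent and so ef' = f'. *)
Lemma pseudoinverse_unique f f' f'' :
  pseudoinverse f f' -> pseudoinverse f f'' -> f' = f''.
Proof.
move=> ff' ff''; have f''f := pseudoinverse_sym ff''.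
have [e f''fe _] := pseudoinverse_factor f''f.
have ef' := composite_divr ff' f''fe.
apply: (composite_fun _ ef').
exact: idem_left_unit (pseudoinverse_idem f''f f''fe) (composite_composable ef').
Qed.

(** * The involution *)

Definition pseudoinverse_image (x : Rel unit (mor G)) : Rel unit (mor G) :=
  [set p | exists2 f, x (p.1, f) & pseudoinverse f p.2].

Hypothesis reg : regular G.

Lemma pseudoinverse_imageK : involutive pseudoinverse_image.
Proof.
move=> x; apply/seteqP; split=> [[u f] /= [f' /= [f'' xf'' f''f'] f'f]|[u f] xf].
  move: f''f' f'f xf'' => /= /pseudoinverse_sym f'f'' f'f.
  by rewrite (pseudoinverse_unique f'f'' f'f).
have [f' ff'] := reg f.
by exists f'; [exists f | exact: pseudoinverse_sym].
Qed.

End Composite.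

(** * The relative H*-algebra *)

Section CompRel.
Variable G : semigroupoid.

Lemma comp_rel_special :
  regular G -> comp_rel G \; (comp_rel G)^-1 = diagonal.
Proof.
move=> reg; apply/seteqP; split=> [[k k'] /= [[g f]]|[k k'] /diagonalP <-] /=.
  by move=> /comp_relE gfk /comp_relE gfk'; exact: composite_fun gfk gfk'.
have [f' /pseudoinverse_factor[e _ ekk]] := reg k.
by exists (e, k); exact/comp_relE.
Qed.

Lemma comp_rel_assoc (m := comp_rel G) :
  m \; (rel_prod diagonal m \; rel_assoc (mor G) (mor G) (mor G)) =
    m \; rel_prod m diagonal.
Proof.
apply/seteqP; split=> [[[[h g] f] l]|[[[h g] f] l]] /=.
  move=> [[_ gf] [[_ [_ _]] [-> -> ->] [/= /diagonalP <- /comp_relE gf_gf]]].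
  move=> /comp_relE h_gf; have [hg hg_hg hg_f] := composite_assocl gf_gf h_gf.
  by exists (hg, f); [split=> //; exact/comp_relE | exact/comp_relE].
move=> [[hg _] [/= /comp_relE hg_hg /diagonalP <-] /comp_relE hg_f].
have [gf gf_gf h_gf] := composite_assocr hg_hg hg_f.
exists (h, gf); last exact/comp_relE.
by exists (h, (g, f)) => //; split=> //; exact/comp_relE.
Qed.

Hypothesis cancel : locally_cancellative G.
Hypothesis reg : regular G.
Variable x : Rel unit (mor G).

(** Read elementwise, one inclusion is right division by h', the other right
    division by h, where regularity supplies the pseudoinverse h' of h. *)
Lemma comp_rel_adjointr (m := comp_rel G) :
  (m \; rel_prod diagonal (pseudoinverse_image x)) \; (rel_runit (mor G))^-1 =
    rel_runit (mor G) \; (rel_prod diagonal x^-1 \; m^-1).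
Proof.
apply/seteqP; split=> [[g k]|[g k]] /=.
  move=> [[g' u] gg' [[_ h'] [/= /diagonalP <- [h xh hh']] /comp_relE gh'k]].
  have {gg'} gE : g = g' := gg'; subst g'.
  exists (k, u) => //; exists (k, h) => //=; apply/comp_relE.
  exact: composite_divr (pseudoinverse_sym hh') gh'k.
move=> [[k' u] [[k'' h] /comp_relE khg [/= /diagonalP k''E xh]] kk'].
have {kk'} kE : k = k' := kk'; subst k'' k'.
have [h' hh'] := reg h.
exists (g, u) => //; exists (g, h'); last first.
  by apply/comp_relE; exact: composite_divr hh' khg.
by split=> //; exists h.
Qed.

Lemma comp_rel_adjointl (m := comp_rel G) :
  (m \; rel_prod (pseudoinverse_image x) diagonal) \; (rel_lunit (mor G))^-1 =
    rel_lunit (mor G) \; (rel_prod x^-1 diagonal \; m^-1).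
Proof.
apply/seteqP; split=> [[f k]|[f k]] /=.
  move=> [[u f'] ff' [[h' _] [/= [h xh hh'] /diagonalP <-] /comp_relE h'fk]].
  have {ff'} fE : f = f' := ff'; subst f'.
  exists (u, k) => //; exists (h, k) => //=; apply/comp_relE.
  exact: composite_divl (pseudoinverse_sym hh') h'fk.
move=> [[u k'] [[h k''] /comp_relE hkf [/= xh /diagonalP k''E]] kk'].
have {kk'} kE : k = k' := kk'; subst k'' k'.
have [h' hh'] := reg h.
exists (u, f) => //; exists (h', f); last first.
  by apply/comp_relE; exact: composite_divl hh' hkf.
by split=> //; exists h.
Qed.

End CompRel.

Theorem theorem31 (G : semigroupoid) :
  locally_cancellative G -> regular G -> relative_Hstar_algebra (comp_rel G).
Proof.
move=> cancel reg; split; first exact: comp_rel_special.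
  exact: comp_rel_assoc.
exists (@pseudoinverse_image G); split; first exact: pseudoinverse_imageK.
by move=> x; split; [exact: comp_rel_adjointr | exact: comp_rel_adjointl].
Qed.
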